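(* Let $Y_0=\{y_k\}_{k\ge0}$, let $\mathrm{H}^-_{y_{s_1}\cdots y_{s_r}}(N)=\sum_{N\ge n_1>\cdots>n_r>0}n_1^{s_1}\cdots n_r^{s_r}$ ($N\in\mathbb{N}$), $\mathrm{H}^-_{1_{Y_0^*}}=1$, and let $\mathrm{H}^-_\bullet:\mathbb{Q}\langle Y_0\rangle\to\mathbb{Q}^{\mathbb{N}}$, $P\mapsto\mathrm{H}^-_P$, be its linear extension. Then: (1) The generating series $\mathrm{H}^-=\sum_{w\in Y_0^*}\mathrm{H}^-_w\,w$ is group-like for the coproduct $\Delta_\ast$, and $\log\mathrm{H}^-$ is primitive for $\Delta_\ast$. (2) $\ker\mathrm{H}^-_\bullet$ is a prime ideal of $(\mathbb{Q}\langle Y_0\rangle,\ast)$, i.e. $\mathbb{Q}\langle Y_0\rangle\setminus\ker\mathrm{H}^-_\bullet$ is closed under $\ast$.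
   Context: The stuffle product $\ast$ on $\mathbb{Q}\langle Y_0\rangle$: $w\ast1=1\ast w=w$, $y_iu\ast y_jv=y_j(y_iu\ast v)+y_i(u\ast y_jv)+y_{i+j}(u\ast v)$. $\Delta_\ast$ is the coproduct dual to $\ast$: $\langle\Delta_\ast(w)\mid u\otimes v\rangle=\langle w\mid u\ast v\rangle$ for words $u,v,w$, extended to series with coefficients in the (commutative) algebra of functions $\mathbb{N}\to\mathbb{Q}$. A series $S$ is group-like if $\langle S|1_{Y_0^*}\rangle=1$ and $\Delta_\ast(S)=S\otimes S$, and primitive if $\Delta_\ast(S)=S\otimes1+1\otimes S$. *)

(* Defs.v *)
(* [functions] supplies the pointwise (classical) ring and
   Q-module structures on nat -> rat. *)
From HB Require Import structures.
From mathcomp Require Import all_boot all_order all_algebra finmap.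
From mathcomp Require Import functions.
From mathcomp.multinomials Require Import monalg.

Set Implicit Arguments.
Unset Strict Implicit.
Unset Printing Implicit Defensive.

Import GRing.Theory.
Local Open Scope ring_scope.

(* The word y_{s_1} ... y_{s_r} is the sequence [:: s_1; ...; s_r]. *)
Definition word : Type := seq nat.

HB.instance Definition _ := Choice.on word.

Lemma word_unit (u v : word) : u ++ v = [::] -> u = [::] /\ v = [::].
Proof. by case: u => //; case: v. Qed.

HB.instance Definition _ := Choice_isMonomialDef.Build word
  (@catA nat) (@cat0s nat) (@cats0 nat) word_unit.

(* Q<Y_0>: the product [*] of this ring is concatenation. *)
Notation ncpoly := {malg rat[word]}.

Definition monom (w : word) : ncpoly := << w >>.

Definition letter (k : nat) : ncpoly := monom [:: k].

Fixpoint stuffle_word (u : word) : word -> ncpoly :=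
  match u with
  | [::] => monom
  | i :: u' =>
    fix stuffle_u (v : word) : ncpoly :=
      match v with
      | [::] => monom u
      | j :: v' => letter j * stuffle_u v'
                   + letter i * stuffle_word u' v
                   + letter (i + j)%N * stuffle_word u' v'
      end
  end.

Lemma stuffle_word_nil_l (v : word) : stuffle_word [::] v = monom v.
Proof. by []. Qed.

Lemma stuffle_word_nil_r (u : word) : stuffle_word u [::] = monom u.
Proof. by case: u. Qed.

Lemma stuffle_word_cons (i j : nat) (u v : word) :
  stuffle_word (i :: u) (j :: v) =
    letter j * stuffle_word (i :: u) v
    + letter i * stuffle_word u (j :: v)
    + letter (i + j)%N * stuffle_word u v.
Proof. by []. Qed.

Definition stuffle (P Q : ncpoly) : ncpoly :=
  \sum_(u <- msupp P) \sum_(v <- msupp Q)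
    (P@_u * Q@_v) *: stuffle_word u v.

(* The algebra Q^N, with pointwise operations; [rat^o] is [rat] with its
   structure of module over itself. *)
Notation coefs := (nat -> rat^o).

(* Series are given by their coefficients. [series] also inherits pointwise
   ring operations from its function type; they are not those of A<<Y_0>> and
   are never used: the unit and the product are [sone] and [smul]. *)
Definition series : Type := word -> coefs.
Definition series2 : Type := word -> word -> coefs.

Definition sone : series := fun w => if w is [::] then 1 else 0.

Definition ssub (S T : series) : series := fun w => S w - T w.

Definition smul (S T : series) : series :=
  fun w => \sum_(i < (size w).+1) S (take i w) * T (drop i w).

Definition spow (S : series) (n : nat) : series := iter n (smul S) sone.

(* log S = sum_(k >= 1) (-1)^(k-1)/k (S - 1)^k for a series S with constant
   term 1; the coefficient at w of (S - 1)^k then vanishes for k > |w|, see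
   [spow_ssub1_eq0]. *)
Definition slog (S : series) : series :=
  fun w => \sum_(1 <= k < (size w).+1)
    ((-1) ^+ k.-1 / k%:R : rat) *: spow (ssub S sone) k w.

Lemma spow_ssub1_eq0 (S : series) (k : nat) (w : word) :
  S [::] = 1 -> (size w < k)%N -> spow (ssub S sone) k w = 0.
Proof.
move=> S1; elim: k w => [|k IHk] w //= lt_wk.
rewrite /smul big1 // => -[i lt_iw] _ /=.
case: i lt_iw => [|i] lt_iw; first by rewrite take0 /ssub S1 subrr mul0r.
rewrite [spow _ _ _]IHk ?mulr0 // size_drop.
case: w lt_wk lt_iw => //= a w lt_wk _.
by rewrite subSS (leq_ltn_trans (leq_subr i (size w))).
Qed.

Definition tensor (S T : series) : series2 := fun u v => S u * T v.

(* <Delta(w) | u (x) v> = <w | u * v> *)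
Definition coprod_word (w u v : word) : rat := (stuffle_word u v)@_w.

(* The coefficient at u (x) v of Delta(S) = sum_w S_w Delta(w); only the w in
   the (finite) support of u * v contribute. *)
Definition coprod (S : series) : series2 :=
  fun u v => \sum_(w <- msupp (stuffle_word u v)) coprod_word w u v *: S w.

Definition group_like (S : series) : Prop :=
  S [::] = 1 /\ coprod S = tensor S S.

Definition primitive (S : series) : Prop :=
  coprod S = (fun u v => tensor S sone u v + tensor sone S u v).

(* The sum ranges over tuples (n_1, ..., n_r) in {0, ..., N}^r with
   n_1 > ... > n_r > 0. *)
Definition Hminus (w : word) : coefs := fun N =>
  \sum_(n : (size w).-tuple 'I_N.+1 |
         sorted gtn [seq val x | x <- n] && all (fun x : 'I_N.+1 => 0 < x)%N n)
    \prod_(i < size w) (tnth n i)%:R ^+ nth 0%N w i.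

Definition Hminus_lin (P : ncpoly) : coefs :=
  \sum_(w <- msupp P) P@_w *: Hminus w.

Definition ker_Hminus (P : ncpoly) : Prop := Hminus_lin P = 0.

Record stuffle_prime_ideal (I : ncpoly -> Prop) : Prop := {
  spi_zero : I 0;
  spi_sub : forall P Q, I P -> I Q -> I (P - Q);
  spi_mull : forall P Q, I Q -> I (stuffle P Q);
  spi_mulr : forall P Q, I P -> I (stuffle P Q);
  spi_proper : ~ I (monom [::]);
  spi_prime : forall P Q, ~ I P -> ~ I Q -> ~ I (stuffle P Q)
}.

(* Main.v *)
(** Call [f : word -> A] a character when its linear extension is
    multiplicative for the stuffle product, i.e. when the series of its
    coefficients is group-like. The coproduct dual to the stuffle is
    multiplicative for concatenation, so that a product of characters is a
    character. Since [n_1] is either at most [N] or equal to [N.+1],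
    [Hminus] at [N.+1] is the product of the character sending [y_s] to
    [N.+1 ^ s] (and longer words to 0) with [Hminus] at [N]; hence [Hminus] is
    group-like.

    The powers [S^k] of a group-like series are group-like, and
    [S^k = sum_j 'C(k, j) (S - 1)^j] has coefficients polynomial in [k].
    The identity [<S^k, u * v> = <S^k, u> <S^k, v>] is thus one between
    polynomials in [k]: its constant terms are the coefficients of [1], and
    its linear terms say that [log S] is primitive.

    Finally, the values of [Hminus] are polynomial functions of [N], and these
    form an integral domain. *)
From HB Require Import structures.
Require Import Defs.
From mathcomp Require Import all_boot all_order all_algebra finmap.
From mathcomp Require Import boolp functions.
From mathcomp.multinomials Require Import monalg.
From mathcomp Require Import ring.

Set Implicit Arguments.
Unset Strict Implicit.
Unset Printing Implicit Defensive.

Import GRing.Theory Num.Theory.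
Local Open Scope fset_scope.
Local Open Scope ring_scope.

Arguments stuffle_word : simpl never.
Arguments spow : simpl never.

(** * Linear extension of functions on words *)

(** Both [Hminus_lin] and [coprod] are instances of this map up to conversion. *)
Definition ext (V : lmodType rat) (h : word -> V) (P : ncpoly) : V :=
  \sum_(w <- msupp P) P@_w *: h w.

Section Ext.
Variables (V : lmodType rat) (h : word -> V).

Lemma extEw (d : {fset word}) P :
  msupp P `<=` d -> ext h P = \sum_(w <- d) P@_w *: h w.
Proof.
move=> le; rewrite /ext (big_fset_incl _ le) => //= x xd /mcoeff_outdom ->.
by rewrite scale0r.
Qed.

Lemma ext_is_linear : linear (ext h).
Proof.
move=> c P Q; pose E := msupp P `|` msupp Q.
have sP : msupp P `<=` E by exact: fsubsetUl.
have sQ : msupp Q `<=` E by exact: fsubsetUr.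
have scP : msupp (c *: P) `<=` E by apply: fsubset_trans sP; exact: msuppZ_le.
rewrite !(@extEw E) //; last first.
  by apply: fsubset_trans (msuppD_le _ _) _; rewrite fsubUset scP sQ.
rewrite scaler_sumr -big_split /=.
by apply: eq_bigr => w _; rewrite mcoeffD mcoeffZ scalerDl scalerA.
Qed.

HB.instance Definition _ := GRing.isLinear.Build rat ncpoly V *:%R (ext h)
  ext_is_linear.

Lemma ext_monom w : ext h (monom w) = h w.
Proof. by rewrite /monom (extEw msuppU_le) big_seq_fset1 mcoeffUU scale1r. Qed.

End Ext.

Lemma ext_letter (V : lmodType rat) (h : word -> V) k P :
  ext h (letter k * P) = ext (fun w => h (k :: w)) P.
Proof.
rewrite {1}[P]monalgE mulr_sumr linear_sum; apply: eq_bigr => w _ /=.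
have -> : letter k * << P@_w *g w >> = P@_w *: monom (k :: w).
  apply/malgP => v; rewrite malgM_def fgmulUU mul1r mcoeffZ !mcoeffU.
  by rewrite mulrnAr mulr1.
by rewrite linearZ /= ext_monom.
Qed.

Lemma eq_ext (V : lmodType rat) (h1 h2 : word -> V) P :
  h1 =1 h2 -> ext h1 P = ext h2 P.
Proof. by move=> eqh; apply: eq_bigr => w _; rewrite eqh. Qed.

Lemma ext_addf (V : lmodType rat) (h1 h2 : word -> V) P :
  ext (fun w => h1 w + h2 w) P = ext h1 P + ext h2 P.
Proof. by rewrite -big_split; apply: eq_bigr => w _; rewrite scalerDr. Qed.

Lemma ext_mull (A : comAlgType rat) (a : A) (h : word -> A) P :
  ext (fun w => a * h w) P = a * ext h P.
Proof. by rewrite mulr_sumr; apply: eq_bigr => w _; rewrite scalerAr. Qed.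

(** * Convolution and characters *)

Definition conv (A : pzRingType) (f g : word -> A) (w : word) : A :=
  \sum_(i < (size w).+1) f (take i w) * g (drop i w).

Lemma conv_nil (A : pzRingType) (f g : word -> A) :
  conv f g [::] = f [::] * g [::].
Proof. by rewrite /conv big_ord1. Qed.

Lemma conv_cons (A : pzRingType) (f g : word -> A) k w :
  conv f g (k :: w) = f [::] * g (k :: w) + conv (fun v => f (k :: v)) g w.
Proof. by rewrite /conv big_ord_recl. Qed.

(** A cut of [k :: w] either precedes [k], so that [f] reads the empty word, or leaves [k] at the
    head of what [f] reads. *)
Lemma ext_conv_letter (A : comAlgType rat) (f g : word -> A) k P :
  ext (conv f g) (letter k * P) =
    f [::] * ext g (letter k * P) + ext (conv (fun w => f (k :: w)) g) P.
Proof.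
rewrite !ext_letter -ext_mull -ext_addf.
by apply: eq_ext => w; exact: conv_cons.
Qed.

(* The dual coproduct of the stuffle product is multiplicative for
   concatenation. *)
Lemma ext_conv (A : comAlgType rat) (f g : word -> A) u v :
  ext (conv f g) (stuffle_word u v) =
    \sum_(i < (size u).+1) \sum_(j < (size v).+1)
      ext f (stuffle_word (take i u) (take j v))
      * ext g (stuffle_word (drop i u) (drop j v)).
Proof.
(* [f] is generalized because stripping a first letter [k] replaces it by [fun w => f (k :: w)]. *)
elim: u v f => [|a u IHu] v f.
  rewrite big_ord1 /= ext_monom; apply: eq_bigr => j _.
  by rewrite !ext_monom.
elim: v f => [|b v IHv] f.
  rewrite stuffle_word_nil_r ext_monom; apply: eq_bigr => i _.
  by rewrite big_ord1 !stuffle_word_nil_r !ext_monom.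
pose T f u v i j := ext f (stuffle_word (take i u) (take j v))
  * ext g (stuffle_word (drop i u) (drop j v)).
rewrite stuffle_word_cons 2!linearD /= !ext_conv_letter.
rewrite IHv (IHu (b :: v)) (IHu v).
set fa := fun w => f (a :: w); set fb := fun w => f (b :: w).
set fab := fun w => f ((a + b)%N :: w).
(* The cuts [(i, j)] form a grid. At the corner [f] reads the empty word and the stuffle recursion
   falls on [g]; on each edge one prefix is empty and a single shifted function occurs; in the
   interior the recursion applies to the prefixes and all three occur. *)
have E0 : T f (a :: u) (b :: v) 0 0 =
    f [::] * ext g (letter b * stuffle_word (a :: u) v)
    + f [::] * ext g (letter a * stuffle_word u (b :: v))
    + f [::] * ext g (letter (a + b)%N * stuffle_word u v).
  rewrite /T !take0 !drop0 stuffle_word_nil_l ext_monom stuffle_word_cons.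
  by rewrite 2!linearD !mulrDr.
have E1 j : T f (a :: u) (b :: v) 0 j.+1 = T fb (a :: u) v 0 j.
  by rewrite /T !take0 !stuffle_word_nil_l !ext_monom.
have E2 i : T f (a :: u) (b :: v) i.+1 0 = T fa u (b :: v) i 0.
  by rewrite /T !take0 !stuffle_word_nil_r !ext_monom.
have E3 i j : T f (a :: u) (b :: v) i.+1 j.+1 =
    T fb (a :: u) v i.+1 j + T fa u (b :: v) i j.+1 + T fab u v i j.
  rewrite /T !take_cons !drop_cons stuffle_word_cons 2!linearD /=.
  by rewrite !ext_letter !mulrDl.
have S1 : \sum_(i < (size (a :: u)).+1) \sum_(j < (size v).+1)
      T fb (a :: u) v i j =
    \sum_(j < (size v).+1) T f (a :: u) (b :: v) 0 j.+1
    + \sum_(i < (size u).+1) \sum_(j < (size v).+1) T fb (a :: u) v i.+1 j.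
  by rewrite big_ord_recl; congr (_ + _); apply: eq_bigr => j _; rewrite E1.
have S2 : \sum_(i < (size u).+1) \sum_(j < (size (b :: v)).+1)
      T fa u (b :: v) i j =
    \sum_(i < (size u).+1) T f (a :: u) (b :: v) i.+1 0
    + \sum_(i < (size u).+1) \sum_(j < (size v).+1) T fa u (b :: v) i j.+1.
  rewrite -big_split /=; apply: eq_bigr => i _.
  by rewrite E2 big_ord_recl.
rewrite S1 S2; transitivity (T f (a :: u) (b :: v) 0 0
    + \sum_(j < (size v).+1) T f (a :: u) (b :: v) 0 j.+1
    + \sum_(i < (size u).+1) (T f (a :: u) (b :: v) i.+1 0
      + \sum_(j < (size v).+1) T f (a :: u) (b :: v) i.+1 j.+1)); last first.
  rewrite [RHS]big_ord_recl; congr (_ + _); first by rewrite [RHS]big_ord_recl.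
  by apply: eq_bigr => i _; rewrite [RHS]big_ord_recl.
rewrite big_split /= E0.
have S3 i : \sum_(j < (size v).+1) T f (a :: u) (b :: v) i.+1 j.+1 =
    \sum_(j < (size v).+1) T fb (a :: u) v i.+1 j
    + \sum_(j < (size v).+1) T fa u (b :: v) i j.+1
    + \sum_(j < (size v).+1) T fab u v i j.
  by rewrite -2!big_split; apply: eq_bigr => j _; rewrite E3.
under [X in _ = _ + (_ + X)]eq_bigr => i _ do rewrite S3.
rewrite 2!big_split /=.
rewrite /T; ring.
Qed.

Definition character (A : comAlgType rat) (f : word -> A) : Prop :=
  f [::] = 1 /\ forall u v, ext f (stuffle_word u v) = f u * f v.

Lemma character_conv (A : comAlgType rat) (f g : word -> A) :
  character f -> character g -> character (conv f g).
Proof.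
case=> f1 fM [g1 gM]; split=> [|u v]; first by rewrite conv_nil f1 g1 mulr1.
rewrite ext_conv /conv mulr_suml; apply: eq_bigr => i _.
rewrite mulr_sumr; apply: eq_bigr => j _.
by rewrite fM gM mulrACA.
Qed.

Definition counit (A : pzRingType) (w : word) : A :=
  if w is [::] then 1 else 0.

Lemma conv1l (A : pzRingType) (f : word -> A) : conv (counit A) f =1 f.
Proof.
move=> w; rewrite /conv big_ord_recl take0 drop0 mul1r big1 ?addr0 // => i _.
by case: w i => [[]|a w i] //=; rewrite mul0r.
Qed.

(** Iterated sums over the single value [x]: a strictly decreasing tuple taken from one value has
    length at most 1. *)
Definition power_series (A : pzRingType) (x : A) (w : word) : A :=
  match w with [::] => 1 | [:: s] => x ^+ s | _ => 0 end.

Lemma ext0 (V : lmodType rat) P : ext (fun _ => 0 : V) P = 0.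
Proof. by rewrite /ext big1 // => w _; rewrite scaler0. Qed.

Lemma character_counit (A : comAlgType rat) : character (counit A).
Proof.
split=> // -[|a u] [|b v]; rewrite ?stuffle_word_nil_r ?ext_monom ?mulr1 //.
  by rewrite /= mul1r.
by rewrite stuffle_word_cons 2!linearD /= !ext_letter !ext0 !addr0 mulr0.
Qed.

(** For two nonempty words, only one-letter words contribute, and then only through the contracted
    letter: [x ^+ (a + b) = x ^+ a * x ^+ b]. *)
Lemma character_power_series (A : comAlgType rat) (x : A) :
  character (power_series x).
Proof.
have extX k P : ext (power_series x) (letter k * P) = x ^+ k * ext (counit A) P.
  rewrite ext_letter -ext_mull; apply: eq_ext => -[|a w] /=.
    by rewrite mulr1.
  by rewrite mulr0.
have [_ epsM] := character_counit A.
split=> // -[|a u] [|b v]; rewrite ?stuffle_word_nil_r ?ext_monom ?mulr1 //.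
  by rewrite /= mul1r.
rewrite stuffle_word_cons 2!linearD /= !extX !epsM.
by case: u v => [|? ?] [|? ?]; rewrite /= ?exprD; ring.
Qed.

(** * Recursion for the harmonic sums, and their character property *)

(** The bound [M] is strict, so that each index serves as the bound of the next sum. *)
Fixpoint nested_sum (w : word) (M : nat) : rat :=
  if w is s :: w' then \sum_(1 <= n < M) n%:R ^+ s * nested_sum w' n else 1.

Lemma big_tuple_cons (T : finType) (r : nat) (P : pred (r.+1.-tuple T))
    (F : r.+1.-tuple T -> rat) :
  \sum_(t | P t) F t = \sum_x \sum_(t | P (cons_tuple x t)) F (cons_tuple x t).
Proof.
rewrite pair_big_dep /=.
rewrite (reindex (fun p : T * r.-tuple T => cons_tuple p.1 p.2)) //=.
exists (fun t => (thead t, behead_tuple t)) => [[x t] _|t _] /=.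
  by congr pair; apply: val_inj.
by rewrite [RHS]tuple_eta; apply: val_inj.
Qed.

(** The index type ['I_K] stays fixed while the bound [M] shrinks along the induction; [path gtn M]
    treats [M] as an index preceding the first one. *)
Lemma nested_sum_tuple (K M : nat) (w : word) : (M <= K)%N ->
  \sum_(n : (size w).-tuple 'I_K |
         path gtn M [seq val x | x <- n] && all (fun x : 'I_K => 0 < x)%N n)
    \prod_(i < size w) (tnth n i)%:R ^+ nth 0%N w i = nested_sum w M.
Proof.
elim: w M => [|s w IHw] M leMK.
  rewrite (big_pred1 [tuple]) ?big_ord0 // => t.
  by rewrite tuple0; apply/esym/eqP.
rewrite big_tuple_cons /=.
transitivity (\sum_(x < K | (0 < x < M)%N) (x%:R ^+ s * nested_sum w x)).
  rewrite [RHS]big_mkcond; apply: eq_bigr => x _.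
  case: ifP => [/andP[x0 xM]|xF].
    rewrite -IHw ?mulr_sumr; last exact: leq_trans (ltnW xM) leMK.
    apply: eq_big => [t|t _]; first by rewrite /= xM x0.
    rewrite big_ord_recl tnth0; congr (_ * _).
    by apply: eq_bigr => i _; rewrite tnthS.
  rewrite big1 // => t /andP[/andP[/= xM _] /andP[x0 _]].
  by rewrite x0 xM in xF.
rewrite -(big_mkord (fun x => 0 < x < M)%N
                    (fun x => x%:R ^+ s * nested_sum w x)).
rewrite [RHS](big_nat_widen 1 M K) // [RHS](@big_nat_widenl _ _ _ _ 0%N) //.
by apply: eq_bigl => x; rewrite andbC.
Qed.

Lemma Hminus_nested_sum (w : word) (N : nat) : Hminus w N = nested_sum w N.+1.
Proof.
rewrite -(@nested_sum_tuple N.+1) // /Hminus; apply: eq_bigl => n.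
congr (_ && _); case: (tval n) => //= x t.
by rewrite ltn_ord.
Qed.

Lemma Hminus_nil (N : nat) : Hminus [::] N = 1.
Proof. by rewrite Hminus_nested_sum. Qed.

Lemma Hminus_cons0 (s : nat) (w : word) : Hminus (s :: w) 0 = 0.
Proof. by rewrite Hminus_nested_sum /= big_geq. Qed.

Lemma Hminus_consS (s : nat) (w : word) (N : nat) :
  Hminus (s :: w) N.+1 = Hminus (s :: w) N + N.+1%:R ^+ s * Hminus w N.
Proof. by rewrite !Hminus_nested_sum /= big_nat_recr. Qed.

Lemma character_eq (A : comAlgType rat) (f g : word -> A) :
  f =1 g -> character f -> character g.
Proof.
move=> eqfg [f1 fM]; split=> [|u v]; first by rewrite -eqfg.
by rewrite -(eq_ext _ eqfg) fM !eqfg.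
Qed.

Lemma character_Hminus (N : nat) : @character rat^o (Hminus^~ N).
Proof.
elim: N => [|N IHN].
  apply: character_eq (character_counit _) => -[|s w].
    by rewrite Hminus_nil.
  by rewrite Hminus_cons0.
have cN := character_power_series (N.+1%:R : rat^o).
apply: character_eq (character_conv cN IHN).
case=> [|s w]; first by rewrite conv_nil !Hminus_nil mulr1.
(* Among the cuts after [s], only the one right after it survives, since [power_series] vanishes on
   longer words. *)
rewrite conv_cons Hminus_consS mul1r; congr (_ + _).
rewrite /conv big_ord_recl take0 drop0 big1 ?addr0 // => i _.
by case: w i => [[]|a w i] //=; rewrite mul0r.
Qed.

(** * Group-like series and their powers *)

Lemma ext_fct (S : series) P (N : nat) : ext S P N = ext (S^~ N) P.
Proof. by rewrite /ext fct_sumE. Qed.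

Lemma conv_fct (S T : series) w (N : nat) :
  smul S T w N = conv (S^~ N : word -> rat^o) (T^~ N) w.
Proof. by rewrite /smul fct_sumE. Qed.

Lemma sone_fct w (N : nat) : sone w N = counit (rat^o) w.
Proof. by case: w. Qed.

(** Operations on coefficients are pointwise, so the condition over the algebra of functions can be
    tested at each [N]. *)
Lemma group_like_character (S : series) :
  group_like S <-> forall N, @character rat^o (S^~ N).
Proof.
split=> [[S1 SM] N|SN].
  split=> [|u v]; first by rewrite S1.
  by rewrite -ext_fct -[RHS]/(tensor S S u v N) -SM.
split; first by apply: funext => N; case: (SN N).
apply: funext => u; apply: funext => v; apply: funext => N.
rewrite -[LHS]/(ext _ _ _) ext_fct.
by case: (SN N) => _ ->.
Qed.

Lemma character_spow (S : series) k (N : nat) :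
  group_like S -> @character rat^o ((spow S k)^~ N).
Proof.
move/group_like_character => SN; elim: k => [|k IHk].
  apply: character_eq (character_counit _) => w.
  by rewrite -(sone_fct w N).
apply: character_eq (character_conv (SN N) IHk) => w.
by rewrite -conv_fct.
Qed.

(** Terms with [j > k] or [j > size w] vanish, so the range [B] can be chosen independently of [k];
    this makes the coefficient polynomial in [k]. *)
Lemma spow_binomial (S : series) (B k : nat) (w : word) :
  S [::] = 1 -> (size w < B)%N ->
  spow S k w = \sum_(j < B) spow (ssub S sone) j w *+ 'C(k, j).
Proof.
move=> S1; set D := ssub S sone; case: B => // B.
elim: k w => [|k IHk] w ltwB.
  rewrite big_ord_recl big1 ?addr0 // => i _.
have -> : spow S k.+1 w = spow S k w + smul D (spow S k) w.
  rewrite -[spow S k w]conv1l -big_split /=; apply: eq_bigr => i _.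
  by rewrite -mulrDl addrC subrK.
have -> : smul D (spow S k) w = \sum_(j < B.+1) spow D j.+1 w *+ 'C(k, j).
  rewrite /smul; under eq_bigr => i _.
    rewrite IHk; last by rewrite size_drop (leq_ltn_trans (leq_subr _ _)).
    rewrite mulr_sumr; under eq_bigr => j _ do rewrite mulrnAr.
    over.
  by rewrite exchange_big; apply: eq_bigr => j _; rewrite sumrMnl.
(* Pascal's rule after an index shift; the surplus top term vanishes because its exponent exceeds
   [size w]. *)
rewrite IHk // [X in X + _]big_ord_recl [X in _ + X]big_ord_recr /=.
rewrite [spow D B.+1 w]spow_ssub1_eq0 // mul0rn addr0 -addrA -big_split.
rewrite big_ord_recl /=.
rewrite !bin0; congr (_ + _); apply: eq_bigr => j _.
by rewrite binS mulrnDr.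
Qed.

(** * Interpolation of the powers, and the logarithm *)

Definition binomial_poly (j : nat) : {poly rat} :=
  (j`!%:R)^-1 *: \prod_(i < j) ('X - i%:R%:P).

Lemma horner_binomial_poly (j k : nat) :
  (binomial_poly j).[k%:R] = 'C(k, j)%:R.
Proof.
rewrite hornerZ horner_prod.
have -> : \prod_(i < j) ('X - (i%:R : rat)%:P).[k%:R] = (k ^_ j)%:R.
  elim: j => [|j IHj]; first by rewrite big_ord0.
  rewrite big_ord_recr /= IHj ffactnSr natrM hornerXsubC.
  have [lejk|ltkj] := leqP j k; first by rewrite natrB.
  by rewrite ffact_small // !mul0r.
by rewrite -bin_ffact natrM mulrC mulfK // pnatr_eq0 -lt0n fact_gt0.
Qed.

Lemma coef0_binomial_poly (j : nat) : (binomial_poly j)`_0 = (j == 0%N)%:R.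
Proof. by rewrite -horner_coef0 (horner_binomial_poly j 0) bin0n eq_sym. Qed.

Lemma coef1_binomial_poly (j : nat) :
  (binomial_poly j.+1)`_1 = (-1) ^+ j / j.+1%:R.
Proof.
rewrite coefZ big_ord_recl subr0 mulrC -[nth _ _ _]/(nth 0 _ 1) coefXM /=.
rewrite -horner_coef0 horner_prod.
under eq_bigr => i _ do rewrite hornerXsubC sub0r.
rewrite prodrN card_ord -natr_prod.
have -> : (\prod_(i < j) bump 0 i = j`!)%N.
  by rewrite fact_prod big_add1 big_mkord.
rewrite factS natrM invfM.
have : j`!%:R != 0 :> rat by rewrite pnatr_eq0 -lt0n fact_gt0.
by move=> nz; rewrite mulrA mulrAC mulfK.
Qed.

Lemma poly_eq_nat (R : numDomainType) (p q : {poly R}) :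
  (forall n : nat, p.[n%:R] = q.[n%:R]) -> p = q.
Proof.
move=> eqpq; apply/eqP; rewrite -subr_eq0; apply/negPn/negP => nz.
pose rs : seq R := [seq i%:R | i <- iota 0 (size (p - q))].
have rs_root : all (root (p - q)) rs.
  by apply/allP => _ /mapP[i _ ->]; rewrite rootE !hornerE eqpq subrr.
have rs_uniq : uniq rs.
  by rewrite map_inj_uniq ?iota_uniq // => i j /eqP; rewrite eqr_nat => /eqP.
by have := max_poly_roots nz rs_root rs_uniq; rewrite size_map size_iota ltnn.
Qed.

(* Interpolates the powers [spow S k], so that its linear coefficient is the
   derivative at [k = 0], i.e. the logarithm. *)
Definition spow_poly (S : series) (N : nat) (w : word) : {poly rat} :=
  \sum_(j < (size w).+1) spow (ssub S sone) j w N *: binomial_poly j.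

Lemma horner_spow_poly (S : series) (N k : nat) (w : word) :
  S [::] = 1 -> (spow_poly S N w).[k%:R] = spow S k w N.
Proof.
move=> S1; rewrite (spow_binomial k S1 (ltnSn _)) fct_sumE horner_sum.
apply: eq_bigr => j _.
by rewrite hornerZ horner_binomial_poly natmulfctE; exact: mulr_natr.
Qed.

Lemma coef0_spow_poly (S : series) (N : nat) (w : word) :
  (spow_poly S N w)`_0 = sone w N.
Proof.
rewrite coef_sum big_ord_recl coefZ coef0_binomial_poly mulr1 big1 ?addr0 //.
by move=> j _; rewrite coefZ coef0_binomial_poly mulr0.
Qed.

Lemma coef1_spow_poly (S : series) (N : nat) (w : word) :
  (spow_poly S N w)`_1 = slog S w N.
Proof.
have b01 : (binomial_poly 0)`_1 = 0 by rewrite coefZ big_ord0 coefC mulr0.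
rewrite coef_sum big_ord_recl coefZ b01 mulr0 add0r.
rewrite /slog big_add1 big_mkord fct_sumE.
apply: eq_bigr => j _.
by rewrite coefZ coef1_binomial_poly mulrC.
Qed.

Lemma ext_spow_poly (S : series) (N : nat) (u v : word) : group_like S ->
  ext (spow_poly S N) (stuffle_word u v) = spow_poly S N u * spow_poly S N v.
Proof.
move=> Sgl; have [S1 _] := Sgl; apply: poly_eq_nat => k.
rewrite hornerM !horner_spow_poly //.
have [_ <-] := character_spow k N Sgl.
rewrite /ext horner_sum; apply: eq_bigr => w _.
by rewrite hornerZ horner_spow_poly.
Qed.

Lemma primitive_slog (S : series) : group_like S -> primitive (slog S).
Proof.
move=> Sgl; apply: funext => u; apply: funext => v; apply: funext => N.
rewrite -[LHS]/(ext (slog S) (stuffle_word u v) N) ext_fct.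
have <- : (ext (spow_poly S N) (stuffle_word u v))`_1 =
          ext (slog S ^~ N : word -> rat^o) (stuffle_word u v).
  rewrite /ext coef_sum; apply: eq_bigr => w _.
  by rewrite coefZ coef1_spow_poly.
(* The linear coefficient of a product is given by the Leibniz rule, the constant terms being those
   of [sone]. *)
rewrite ext_spow_poly // coefM 2!big_ord_recl big_ord0 addr0 addrC /=.
by rewrite !coef0_spow_poly !coef1_spow_poly.
Qed.

(** * Polynomiality in [N] *)

Lemma exists_sum_pow (s : nat) : exists p : {poly rat},
  forall N : nat, p.[N%:R] = \sum_(n < N) n%:R ^+ s.
Proof.
elim/ltn_ind: s => s IHs.
have [p pE] := choice (fun i : 'I_s => IHs i (ltn_ord i)).
(* Summing the expansion of [(n + 1) ^ s.+1 - n ^ s.+1] over [n < N] telescopes to [N ^ s.+1]; the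
   witness solves this for the sum of [n ^ s]. *)
exists (s.+1%:R^-1 *: ('X^(s.+1) - \sum_(i < s) 'C(s.+1, i)%:R *: p i)) => N.
have nz : s.+1%:R != 0 :> rat by rewrite pnatr_eq0.
apply: (mulfI nz); rewrite hornerZ mulrA divff // mul1r.
rewrite !hornerE horner_sum mulr_sumr.
under eq_bigr => i _ do rewrite hornerZ pE mulr_sumr.
rewrite exchange_big /=; apply/eqP; rewrite subr_eq -big_split /=; apply/eqP.
elim: N => [|N IHN]; first by rewrite expr0n big_ord0.
rewrite big_ord_recr -IHN /= -natr1 exprD1n !big_ord_recr /= binn mulr1n.
rewrite binSn -[N%:R ^+ s *+ _]mulr_natl addrC [X in _ + X]addrC.
by congr (_ + (_ + _)); apply: eq_bigr => i _; rewrite mulr_natl.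
Qed.

Lemma exists_sum_poly (q : {poly rat}) : exists p : {poly rat},
  forall N : nat, p.[N%:R] = \sum_(n < N) q.[n%:R].
Proof.
have [p pE] := choice exists_sum_pow.
exists (\sum_(i < size q) q`_i *: p i) => N.
rewrite horner_sum; under eq_bigr => i _ do rewrite hornerZ pE mulr_sumr.
by rewrite exchange_big; apply: eq_bigr => n _; rewrite horner_coef.
Qed.

Lemma Hminus_polynomial (w : word) : exists p : {poly rat},
  forall N : nat, Hminus w N = p.[N%:R].
Proof.
elim: w => [|s w [q qE]].
  by exists 1 => N; rewrite Hminus_nil hornerE.
(* With first index [n + 1], the remaining indices are at most [n]: hence the shift in ['X + 1] but
   not in [q]. *)
have [p pE] := exists_sum_poly (('X + 1) ^+ s * q).
exists p => N; rewrite pE; elim: N => [|N IHN].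
  by rewrite big_ord0 Hminus_cons0.
by rewrite Hminus_consS IHN big_ord_recr qE /= !hornerE natr1.
Qed.

Lemma Hminus_lin_polynomial (P : ncpoly) : exists p : {poly rat},
  forall N : nat, Hminus_lin P N = p.[N%:R].
Proof.
have [p pE] := choice Hminus_polynomial.
exists (ext p P) => N.
rewrite -[Hminus_lin P]/(ext Hminus P) ext_fct /ext horner_sum.
by apply: eq_bigr => w _; rewrite hornerZ pE.
Qed.

(** * The kernel is a prime ideal *)

Lemma ext_stuffle (A : comAlgType rat) (f : word -> A) P Q :
  character f -> ext f (stuffle P Q) = ext f P * ext f Q.
Proof.
case=> _ fM; rewrite linear_sum mulr_suml; apply: eq_bigr => u _.
rewrite linear_sum mulr_sumr; apply: eq_bigr => v _.
by rewrite linearZ /= fM -scalerAl -scalerAr scalerA.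
Qed.

Lemma Hminus_lin_stuffle (P Q : ncpoly) (N : nat) :
  Hminus_lin (stuffle P Q) N = Hminus_lin P N * Hminus_lin Q N.
Proof.
rewrite -![Hminus_lin _]/(ext Hminus _) !ext_fct.
exact: ext_stuffle (character_Hminus N).
Qed.

Lemma stuffle_prime_ideal_ker_Hminus : stuffle_prime_ideal ker_Hminus.
Proof.
have evalE P : ker_Hminus P <-> forall N, Hminus_lin P N = 0.
  by split=> [-> //|P0]; apply: funext.
split.
- exact: (linear0 (ext Hminus)).
- move=> P Q P0 Q0; rewrite /ker_Hminus [LHS](linearB (ext Hminus)).
  by rewrite /= -![ext Hminus _]/(Hminus_lin _) P0 Q0 subr0.
- move=> P Q /evalE Q0; apply/evalE => N.
  by rewrite Hminus_lin_stuffle Q0 mulr0.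
- move=> P Q /evalE P0; apply/evalE => N.
  by rewrite Hminus_lin_stuffle P0 mul0r.
- move=> /evalE/(_ 0%N)/eqP; rewrite -[Hminus_lin _]/(ext Hminus _) ext_monom.
  by rewrite Hminus_nil oner_eq0.
move=> P Q nP nQ /evalE PQ0.
(* Functions on [nat] have zero divisors, so the vanishing product is lifted to [{poly rat}]. *)
have [[p pE] [q qE]] := (Hminus_lin_polynomial P, Hminus_lin_polynomial Q).
have /eqP : p * q = 0.
  apply: poly_eq_nat => N.
  by rewrite hornerM -pE -qE -Hminus_lin_stuffle PQ0 horner0.
rewrite mulf_eq0 => /orP[] /eqP r0; [apply: nP|apply: nQ]; apply/evalE => N.
  by rewrite pE r0 horner0.
by rewrite qE r0 horner0.
Qed.

Theorem theorem4 :
  (group_like Hminus /\ primitive (slog Hminus)) /\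
  stuffle_prime_ideal ker_Hminus.
Proof.
have Hgl : group_like Hminus.
  by apply/group_like_character => N; exact: character_Hminus.
split; last exact: stuffle_prime_ideal_ker_Hminus.
by split=> //; exact: primitive_slog.
Qed.
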